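(* Let $R$ be a ring and $\mathcal{I}$ a downward filtered set of two-sided ideals of $R$. Suppose that for each $I\in\mathcal{I}$, $$\bigcap_{J}\big((J:I)+I\big)=I,$$ where $J$ runs over all ideals in $\mathcal{I}$ with $J\subseteq I$. Then the following hold: (a) ${}_{R}^{g}\mathrm{Mod}$ has no non-zero projective objects. (b) ${}_{R}^{g}\mathrm{Mod}$ does not satisfy $\mathrm{Ab4}^*$.
   Context: Rings are associative and unital, and modules are left modules; ${}_R\mathrm{Mod}$ is the category of left $R$-modules. A downward filtered set of ideals of $R$ is a non-empty set $\mathcal{I}$ of two-sided ideals of $R$ such that for any $I_1,I_2\in\mathcal{I}$ there exists $J\in\mathcal{I}$ with $J\subseteq I_1$ and $J\subseteq I_2$. For an ideal $I$ and $M\in{}_R\mathrm{Mod}$ put $M_I:=\{x\in M\mid Ix=0\}$. ${}_{R}^{g}\mathrm{Mod}$ is the full subcategory of ${}_R\mathrm{Mod}$ consisting of those modules $M$ with $M=\varinjlim_{I\in\mathcal{I}}M_I$, i.e. $M=\bigcup_{I\in\mathcal{I}}M_I$. It is closed under subobjects, quotients and coproducts in ${}_R\mathrm{Mod}$ and is a Grothendieck category; the product of a family in ${}_{R}^{g}\mathrm{Mod}$ is $\bigcup_{I\in\mathcal{I}}P_I$, where $P$ is the product in ${}_R\mathrm{Mod}$. For two ideals $I,J\subseteq R$, $(J:I):=\{r\in R\mid Ir\subseteq J\}$. Projectivity means projectivity as an object of ${}_{R}^{g}\mathrm{Mod}$. A Grothendieck category satisfies $\mathrm{Ab4}^*$ if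 products in it are exact, i.e. the product of any set-indexed family of epimorphisms is an epimorphism.
   Formalization: Part (b) is stated for a set of ideals other than {R}: if the only ideal in the set is R itself, the hypothesis holds but the category is zero and satisfies Ab4* trivially, so (b) fails there. *)

(* Defs.v *)
From HB Require Import structures.
From mathcomp Require Import all_boot all_order all_algebra.
From mathcomp Require Import boolp classical_sets.

Set Implicit Arguments.
Unset Strict Implicit.
Unset Printing Implicit Defensive.

Import GRing.Theory.

Local Open Scope classical_set_scope.
Local Open Scope ring_scope.

(* The zero ring is allowed, hence pzRingType throughout. *)

Definition two_sided_ideal (R : pzRingType) (I : set R) : Prop :=
  [/\ I 0,
      (forall x y, I x -> I y -> I (x + y)),
      (forall a x, I x -> I (a * x))
    & (forall a x, I x -> I (x * a))].

Definition downward_filtered_ideals (R : pzRingType) (F : set (set R)) : Prop :=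
  [/\ F !=set0,
      (forall I, F I -> two_sided_ideal I)
    & (forall I1 I2, F I1 -> F I2 ->
         exists J, [/\ F J, J `<=` I1 & J `<=` I2])].

(* (J : I) = {r | I r ⊆ J}; r multiplies on the right. *)
Definition ideal_colon (R : pzRingType) (J I : set R) : set R :=
  [set r | forall a, I a -> J (a * r)].

Definition ideal_add (R : pzRingType) (I J : set R) : set R :=
  [set x + y | x in I & y in J].

(* M_I *)
Definition ann_by (R : pzRingType) (M : lmodType R) (I : set R) : set M :=
  [set x | forall a, I a -> a *: x = 0].
Arguments ann_by {R} M I.

(* Objects of gMod. It is a full subcategory, so its morphisms are all the
   R-linear maps between objects. *)
Definition in_gmod (R : pzRingType) (F : set (set R)) (M : lmodType R) : Prop :=
  \bigcup_(I in F) ann_by M I = setT.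

(* Epimorphism of gMod: test objects range over gMod only. *)
Definition gmod_epi (R : pzRingType) (F : set (set R)) (M N : lmodType R)
    (f : {linear M -> N}) : Prop :=
  forall (Z : lmodType R) (g h : {linear N -> Z}), in_gmod F Z ->
    g \o f =1 h \o f -> g =1 h.

Definition gmod_projective (R : pzRingType) (F : set (set R)) (P : lmodType R)
    : Prop :=
  in_gmod F P /\
  forall (M N : lmodType R) (e : {linear M -> N}) (f : {linear P -> N}),
    in_gmod F M -> in_gmod F N -> gmod_epi F e ->
    exists g : {linear P -> M}, e \o g =1 f.

(* (P, p) is a product of the family M in gMod. *)
Definition gmod_product (R : pzRingType) (F : set (set R)) (T : Type)
    (M : T -> lmodType R) (P : lmodType R) (p : forall t, {linear P -> M t})
    : Prop :=
  in_gmod F P /\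
  forall (Z : lmodType R) (z : forall t, {linear Z -> M t}), in_gmod F Z ->
    (exists u : {linear Z -> P}, forall t, p t \o u =1 z t) /\
    (forall u v : {linear Z -> P},
       (forall t, p t \o u =1 p t \o v) -> u =1 v).

(* u is the product map of the f t, pinned down by q t \o u = f t \o p t. *)
Definition gmod_Ab4star (R : pzRingType) (F : set (set R)) : Prop :=
  forall (T : Type) (M N : T -> lmodType R) (f : forall t, {linear M t -> N t}),
    (forall t, in_gmod F (M t)) -> (forall t, in_gmod F (N t)) ->
    (forall t, gmod_epi F (f t)) ->
  forall (P Q : lmodType R)
         (p : forall t, {linear P -> M t}) (q : forall t, {linear Q -> N t}),
    gmod_product F p -> gmod_product F q ->
  forall u : {linear P -> Q},
    (forall t, q t \o u =1 f t \o p t) -> gmod_epi F u.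

(* Main.v *)
Require Import Defs.
From HB Require Import structures.
From mathcomp Require Import all_boot all_order all_algebra.
From mathcomp Require Import boolp classical_sets.

Set Implicit Arguments.
Unset Strict Implicit.
Unset Printing Implicit Defensive.

Import GRing.Theory.

Local Open Scope classical_set_scope.
Local Open Scope ring_scope.

(** Write R/J for the cyclic module attached to J in F.  Two facts about gMod
are used throughout: its epimorphisms are the surjections (test an epimorphism
against its cokernel), and every surjection R/J -> R/K with J inside K is one.

No projectives.  Let P be projective, phi : P -> R/J linear and y in P.  Pick K
in F inside J that annihilates y.  Projectivity lifts phi to psi : P -> R/K
and, for each L in F inside K, lifts psi further to P -> R/L.  The value of the
last map at y is the class of some l with K l inside L, so psi y is represented
by an element of (L : K) for every such L.  The hypothesis on K gives psi y = 0,
hence phi y = 0 ([hom_proj_cyc_eq0]).  So all maps from P to the modules R/J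
vanish.  But P is covered by the direct sum of the modules R/A_x, where A_x in
F annihilates x; this sum lies in gMod and embeds in a product of modules R/J,
so a section P -> sum of that cover is zero, and P = 0 ([projective_eq0]).

No Ab4*.  Products in gMod are the torsion parts of products of modules.  Take
the product of all the surjections R/J -> R/K, each repeated once for each r in
R.  Given I in F, the family whose entry at (J, K, r) is the class of r if r is
in (K : I), and 0 otherwise, is annihilated by I, so it belongs to the product
of the targets.  A preimage is annihilated by a single I' in F, which says that
(K : I) is contained in (J : I') + K for all J inside K ([Ab4star_colon]).
Applying this to I and then to the resulting I1 gives I2 inside I1.  With K = I2
it reads: (I2 : I1) is in (J : I2) + I2 for all J inside I2, so it is in I2 by
the hypothesis on I2.  With K = I and J = I2 it reads: R = (I : I) is contained
in (I2 : I1) + I, hence in I.  So R is the only member of F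
([Ab4star_trivial]). *)

(** * Submodules, quotients and products of modules *)

Definition linear_of (R : pzRingType) (U V : lmodType R) (f : U -> V)
  (Hf : linear f) : {linear U -> V} :=
  HB.pack f (GRing.isLinear.Build R U V *:%R f Hf).

(** Homomorphism theorem: a set-theoretic section of [e] followed by [f] is
linear, because [f] identifies all preimages of a point. *)
Lemma linear_factor (R : pzRingType) (U V W : lmodType R)
    (e : {linear U -> V}) (f : {linear U -> W}) :
  (forall y, exists x, e x = y) -> (forall x, e x = 0 -> f x = 0) ->
  exists g : {linear V -> W}, forall x, g (e x) = f x.
Proof.
move=> esurj kerS.
have f_eq x x' : e x = e x' -> f x = f x'.
  move=> exx'; apply/subr0_eq; rewrite -linearB; apply: kerS.
  by rewrite linearB exx' subrr.
have [s es] := choice esurj.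
have g_lin : linear (f \o s).
  move=> a y z /=; rewrite -linearP; apply: f_eq.
  by rewrite linearP /= !es.
by exists (linear_of g_lin) => x /=; apply: f_eq; rewrite es.
Qed.

Section Submodules.
Variables (R : pzRingType) (V : lmodType R).

Definition is_submodule (S : set V) : Prop :=
  S 0 /\ forall a x y, S x -> S y -> S (a *: x + y).

Variables (S : set V) (HS : is_submodule S).

(** The proof of closure is an argument so that the algebraic structure of the
predicate can be inferred from its name. *)
Definition submodule_pred of is_submodule S : pred V := fun x => `[< S x >].

Fact submodule_pred_closed : submod_closed (submodule_pred HS).
Proof.
case: (HS) => S0 Slin; split; first exact/asboolP.
by move=> a x y /asboolP Sx /asboolP Sy; apply/asboolP; apply: Slin.
Qed.

HB.instance Definition _ :=
  GRing.isSubmodClosed.Build R V (submodule_pred HS) submodule_pred_closed.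

Definition submodule_type := {x : V | submodule_pred HS x}.
HB.instance Definition _ := Choice.on submodule_type.
HB.instance Definition _ := SubType.on submodule_type.
HB.instance Definition _ :=
  [SubChoice_isSubLmodule of submodule_type by <:].

Definition submodule : lmodType R := submodule_type.
Definition sub_incl : {linear submodule -> V} :=
  [the {linear _ -> _} of (val : submodule_type -> V)].

Lemma sub_incl_inj : injective sub_incl.
Proof. exact: val_inj. Qed.

Lemma sub_incl_in (x : submodule) : S (sub_incl x).
Proof. exact/asboolP/(valP x). Qed.

Lemma sub_incl_onto (x : V) : S x -> exists y, sub_incl y = x.
Proof.
by move=> /asboolP Sx; exists (exist _ x Sx : submodule_type).
Qed.


Definition submodule_zmodClosed : zmodClosed V :=
  HB.pack (submodule_pred HS)
    (GRing.isZmodClosed.Build V (submodule_pred HS)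
       (GRing.submod_closedB submodule_pred_closed)).

Definition quotient_type := Quotient.quot submodule_zmodClosed.
HB.instance Definition _ := GRing.Zmodule.on quotient_type.

Local Notation pi :=
  (\pi_(Quotient.quot submodule_zmodClosed)%qT : V -> quotient_type).

Fact pi_eq x y : pi x = pi y <-> S (x - y).
Proof.
split; first by move=> /eqP; rewrite -Quotient.idealrBE => /asboolP.
by move=> Sxy; apply/eqP; rewrite -Quotient.idealrBE; apply/asboolP.
Qed.

Definition quotient_scale (a : R) (q : quotient_type) : quotient_type :=
  pi (a *: repr (q : Quotient.quot submodule_zmodClosed)).

Fact pi_scale a x : quotient_scale a (pi x) = pi (a *: x).
Proof.
apply/pi_eq; rewrite -scalerBr -[_ *: _]addr0.
by case: (HS) => S0 Slin; apply/Slin/S0; apply/pi_eq; rewrite reprK.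
Qed.

Fact pi_surj (q : quotient_type) : exists x, pi x = q.
Proof.
by exists (repr (q : Quotient.quot submodule_zmodClosed)); rewrite reprK.
Qed.

Fact pi_add x y : pi (x + y) = pi x + pi y.
Proof. by rewrite piE. Qed.

Fact quotient_scalerA a b q :
  quotient_scale a (quotient_scale b q) = quotient_scale (a * b) q.
Proof. by have [x <-] := pi_surj q; rewrite !pi_scale scalerA. Qed.

Fact quotient_scale1r : left_id 1 quotient_scale.
Proof. by move=> q; have [x <-] := pi_surj q; rewrite pi_scale scale1r. Qed.

Fact quotient_scalerDr : right_distributive quotient_scale +%R.
Proof.
move=> a p q; have [x <-] := pi_surj p; have [y <-] := pi_surj q.
by rewrite -pi_add !pi_scale scalerDr pi_add.
Qed.

Fact quotient_scalerDl q : {morph quotient_scale^~ q : a b / a + b}.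
Proof.
by move=> a b; have [x <-] := pi_surj q; rewrite !pi_scale scalerDl pi_add.
Qed.

HB.instance Definition _ := GRing.Zmodule_isLmodule.Build R quotient_type
  quotient_scalerA quotient_scale1r quotient_scalerDr quotient_scalerDl.

Definition quotient : lmodType R := quotient_type.

Fact pi_linear : linear (pi : V -> quotient).
Proof. by move=> a x y; rewrite pi_add -pi_scale. Qed.

Definition quotient_pi : {linear V -> quotient} := linear_of pi_linear.

Lemma quotient_pi_surj (q : quotient) : exists x, quotient_pi x = q.
Proof. exact: pi_surj. Qed.

Lemma quotient_pi_eq0 x : quotient_pi x = 0 <-> S x.
Proof. by rewrite -(linear0 quotient_pi) -[x in S x]subr0; exact: pi_eq. Qed.

End Submodules.

Section Product.
Variables (R : pzRingType) (T : Type) (M : T -> lmodType R).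

Definition dprod_type := forall t, M t.
HB.instance Definition _ := gen_eqMixin dprod_type.
HB.instance Definition _ := gen_choiceMixin dprod_type.

Definition dprod_zero : dprod_type := fun=> 0.
Definition dprod_opp (x : dprod_type) : dprod_type := fun t => - x t.
Definition dprod_add (x y : dprod_type) : dprod_type := fun t => x t + y t.
Definition dprod_scale (a : R) (x : dprod_type) : dprod_type :=
  fun t => a *: x t.

Local Notation dext := functional_extensionality_dep.

Fact dprod_addA : associative dprod_add.
Proof. by move=> x y z; apply: dext => t; exact: addrA. Qed.

Fact dprod_addC : commutative dprod_add.
Proof. by move=> x y; apply: dext => t; exact: addrC. Qed.

Fact dprod_add0 : left_id dprod_zero dprod_add.
Proof. by move=> x; apply: dext => t; exact: add0r. Qed.

Fact dprod_addN : left_inverse dprod_zero dprod_opp dprod_add.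
Proof. by move=> x; apply: dext => t; exact: addNr. Qed.

HB.instance Definition _ := GRing.isZmodule.Build dprod_type
  dprod_addA dprod_addC dprod_add0 dprod_addN.

Fact dprod_scalerA a b x :
  dprod_scale a (dprod_scale b x) = dprod_scale (a * b) x.
Proof. by apply: dext => t; exact: scalerA. Qed.

Fact dprod_scale1r : left_id 1 dprod_scale.
Proof. by move=> x; apply: dext => t; exact: scale1r. Qed.

Fact dprod_scalerDr : right_distributive dprod_scale +%R.
Proof. by move=> a x y; apply: dext => t; exact: scalerDr. Qed.

Fact dprod_scalerDl x : {morph dprod_scale^~ x : a b / a + b}.
Proof. by move=> a b; apply: dext => t; exact: scalerDl. Qed.

HB.instance Definition _ := GRing.Zmodule_isLmodule.Build R dprod_type
  dprod_scalerA dprod_scale1r dprod_scalerDr dprod_scalerDl.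

Definition dprod : lmodType R := dprod_type.

Fact dprod_proj_linear t : linear ((fun x => x t) : dprod -> M t).
Proof. by []. Qed.

Definition dprod_proj t : {linear dprod -> M t} :=
  linear_of (dprod_proj_linear t).

End Product.


(** * Epimorphisms and products in gMod *)

Lemma gmod_epi_of_surj (R : pzRingType) (F : set (set R)) (M N : lmodType R)
    (f : {linear M -> N}) :
  (forall y, exists x, f x = y) -> gmod_epi F f.
Proof. by move=> fsurj Z g h _ gh y; have [x <-] := fsurj y; exact: gh. Qed.

Lemma in_gmodP (R : pzRingType) (F : set (set R)) (M : lmodType R) :
  in_gmod F M <-> forall x : M, exists2 I, F I & forall a, I a -> a *: x = 0.
Proof.
split=> [MF x|MF].
  by have : [set: M] x by []; rewrite -MF => -[I FI Ix]; exists I.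
by apply/seteqP; split=> // x _; have [I FI Ix] := MF x; exists I.
Qed.

Lemma in_gmod_surj (R : pzRingType) (F : set (set R)) (M N : lmodType R)
    (f : {linear M -> N}) :
  (forall y, exists x, f x = y) -> in_gmod F M -> in_gmod F N.
Proof.
move=> fsurj /in_gmodP MF; apply/in_gmodP => y; have [x <-] := fsurj y.
have [I FI Ix] := MF x; exists I => // a Ia.
by rewrite -linearZ Ix // linear0.
Qed.

(** After an epimorphism, the projection onto its cokernel and the zero map
agree; the cokernel is in gMod, so it vanishes. *)
Lemma gmod_epi_surj (R : pzRingType) (F : set (set R)) (M N : lmodType R)
    (f : {linear M -> N}) :
  in_gmod F N -> gmod_epi F f -> forall y, exists x, f x = y.
Proof.
move=> NF fepi.
have range_sub : is_submodule [set y | exists x, f x = y].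
  split; first by exists 0; rewrite linear0.
  by move=> a _ _ [x <-] [y <-]; exists (a *: x + y); rewrite linearP.
have QF := in_gmod_surj (quotient_pi_surj (HS := range_sub)) NF.
pose z : {linear N -> quotient range_sub} := \0.
have pi0 := fepi _ (quotient_pi range_sub) z QF.
move=> y; apply/(quotient_pi_eq0 range_sub); rewrite pi0 // => x /=.
by apply/quotient_pi_eq0; exists x.
Qed.

Section Filtered.
Variables (R : pzRingType) (F : set (set R)) (hF : downward_filtered_ideals F).

Definition torsion (V : lmodType R) : set V :=
  [set x | exists2 I, F I & forall a, I a -> a *: x = 0].

(** Sums need the filtering of [F]; scalars need the ideals to absorb
multiplication on the right, since I (a x) = (I a) x. *)
Lemma torsion_submodule V : is_submodule (@torsion V).
Proof.
case: hF => -[I0 FI0] Fid Ffilt; split.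
  by exists I0 => // a _; rewrite scaler0.
move=> a x y [I FI Ix] [J FJ Jy]; have [K [FK KI KJ]] := Ffilt _ _ FI FJ.
exists K => // b Kb; rewrite scalerDr scalerA Jy ?addr0; last exact: KJ.
by apply: Ix; apply: KI; case: (Fid _ FK) => _ _ _; apply.
Qed.

Lemma torsion_in_gmod (V : lmodType R) (S : set V) (HS : is_submodule S) :
  S `<=` @torsion V -> in_gmod F (submodule HS).
Proof.
move=> ST; apply/in_gmodP => x; have [I FI Ix] := ST _ (sub_incl_in x).
exists I => // a Ia; apply: (@sub_incl_inj _ _ _ HS).
by rewrite linearZ linear0 /= Ix.
Qed.

Section GmodProduct.
Variables (T : Type) (M : T -> lmodType R).

(** The product in gMod, not the one of R-modules: its elements are the
families annihilated by one member of [F] in all coordinates at once. *)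
Definition gprod : lmodType R := submodule (torsion_submodule (dprod M)).

Definition gprod_proj t : {linear gprod -> M t} :=
  dprod_proj M t \o sub_incl (torsion_submodule (dprod M)).

Lemma gprod_onto (x : forall t, M t) I :
  F I -> (forall t a, I a -> a *: x t = 0) ->
  exists y : gprod, forall t, gprod_proj t y = x t.
Proof.
move=> FI Ix; have xT : torsion (x : dprod M).
  by exists I => // a Ia; apply: functional_extensionality_dep => t; apply: Ix.
have [y yx] := sub_incl_onto (torsion_submodule (dprod M)) xT.
by exists y => t; exact: (congr1 (fun z => z t) yx).
Qed.

Lemma gprod_inj (x y : gprod) :
  (forall t, gprod_proj t x = gprod_proj t y) -> x = y.
Proof.
move=> xy; apply: (@sub_incl_inj _ _ _ (torsion_submodule (dprod M))).
exact: functional_extensionality_dep.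
Qed.

Lemma gprod_product : gmod_product F gprod_proj.
Proof.
split; first exact: torsion_in_gmod.
move=> Z z /in_gmodP ZF; split; last first.
  by move=> u v uv x; apply: gprod_inj => t; apply: uv.
have zx x : exists y : gprod, forall t, gprod_proj t y = z t x.
  have [I FI Ix] := ZF x.
  apply: (gprod_onto FI) => t a Ia.
  by rewrite -linearZ Ix // linear0.
have [u uE] := choice zx.
have u_lin : linear u.
  by move=> a x y; apply: gprod_inj => t; rewrite linearP !uE linearP.
by exists (linear_of u_lin) => t x; rewrite /= -uE.
Qed.

End GmodProduct.

(** * The cyclic modules R/J *)

Definition filter_ideal := {J : set R | F J}.
Implicit Types I J K L : filter_ideal.

Lemma filter_ideal_submodule J : is_submodule (sval J : set R^o).
Proof.
case: hF => _ Fid _; case: (Fid _ (svalP J)) => J0 JD JM _.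
by split=> // a x y Jx Jy; apply/JD/Jy/JM.
Qed.

(** R/J, cyclic on the class of 1. *)
Definition cyc J : lmodType R := quotient (filter_ideal_submodule J).
Definition cyc_pi J : {linear R^o -> cyc J} :=
  quotient_pi (filter_ideal_submodule J).

Lemma cyc_pi_surj J (y : cyc J) : exists r, cyc_pi J r = y.
Proof. exact: quotient_pi_surj. Qed.

Lemma cyc_pi_eq0 J r : cyc_pi J r = 0 <-> sval J r.
Proof. exact: quotient_pi_eq0. Qed.

Lemma scale_cyc_pi J a r : a *: cyc_pi J r = cyc_pi J (a * r).
Proof. by rewrite -linearZ. Qed.

Lemma cyc_in_gmod J : in_gmod F (cyc J).
Proof.
apply/in_gmodP => x; exists (sval J); first exact: svalP.
move=> a Ja; have [r <-] := cyc_pi_surj x; rewrite scale_cyc_pi.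
apply/cyc_pi_eq0; case: hF => _ Fid _.
by case: (Fid _ (svalP J)) => _ _ _; apply.
Qed.

Lemma cyc_map_exists J K : sval J `<=` sval K ->
  exists f : {linear cyc J -> cyc K}, forall r, f (cyc_pi J r) = cyc_pi K r.
Proof.
move=> JK; apply: linear_factor; first exact: cyc_pi_surj.
by move=> r /cyc_pi_eq0/JK/cyc_pi_eq0.
Qed.

Definition cyc_map J K (JK : sval J `<=` sval K) : {linear cyc J -> cyc K} :=
  sval (cid (cyc_map_exists JK)).

Lemma cyc_mapE J K (JK : sval J `<=` sval K) r :
  cyc_map JK (cyc_pi J r) = cyc_pi K r.
Proof. exact: svalP (cid (cyc_map_exists JK)) r. Qed.

Lemma cyc_map_epi J K (JK : sval J `<=` sval K) : gmod_epi F (cyc_map JK).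
Proof.
apply: gmod_epi_of_surj => y; have [r <-] := cyc_pi_surj y.
by exists (cyc_pi J r); rewrite cyc_mapE.
Qed.

Hypothesis hI : forall I : set R, F I ->
  \bigcap_(J in [set J : set R | F J /\ J `<=` I])
     ideal_add (ideal_colon J I) I = I.

Lemma filter_ideal_meet I J :
  exists K, sval K `<=` sval I /\ sval K `<=` sval J.
Proof.
case: hF => _ _ Ffilt; have [K [FK KI KJ]] := Ffilt _ _ (svalP I) (svalP J).
by exists (exist _ K FK).
Qed.

Lemma mem_of_colon K r :
  (forall L, sval L `<=` sval K ->
     ideal_add (ideal_colon (sval L) (sval K)) (sval K) r) -> sval K r.
Proof.
move=> Kr; rewrite -(hI (svalP K)) => L [FL LK].
exact: (Kr (exist _ L FL)).
Qed.

(** * Projective objects vanish *)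

Section Projective.
Variables (P : lmodType R) (projP : gmod_projective F P).

Lemma hom_proj_lift J K (JK : sval J `<=` sval K) (phi : {linear P -> cyc K}) :
  exists psi : {linear P -> cyc J}, forall y, cyc_map JK (psi y) = phi y.
Proof.
case: projP => _ lift.
exact: lift (cyc_in_gmod J) (cyc_in_gmod K) (cyc_map_epi (JK := JK)).
Qed.

(** A lift P -> R/L sends an element killed by K to a class [l] with K l inside
L.  Since [psi y], lifted along every L inside K, is thus represented in each
(L : K), it is zero. *)
Lemma hom_proj_cyc_eq0 J (phi : {linear P -> cyc J}) y : phi y = 0.
Proof.
have /in_gmodP PF := projP.1.
have [I FI Iy] := PF y.
have [K [KI KJ]] := filter_ideal_meet (exist _ I FI) J.
have [psi psiE] := hom_proj_lift KJ phi.
have [k kE] := cyc_pi_surj (psi y).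
rewrite -psiE -kE cyc_mapE; apply/cyc_pi_eq0/KJ/mem_of_colon => L LK.
have [chi chiE] := hom_proj_lift LK psi.
have [l lE] := cyc_pi_surj (chi y).
exists l.
  move=> a Ka; apply/cyc_pi_eq0.
  rewrite -scale_cyc_pi lE -linearZ Iy ?linear0 //.
  exact: KI.
exists (k - l); last by rewrite addrC subrK.
by apply/cyc_pi_eq0; rewrite linearB kE -chiE -lE cyc_mapE subrr.
Qed.

Lemma annihilator_choice : exists A : P -> filter_ideal,
  forall x a, sval (A x) a -> a *: x = 0.
Proof.
have /in_gmodP PF := projP.1.
have annP (x : P) : exists J : filter_ideal, forall a, sval J a -> a *: x = 0.
  by have [I FI Ix] := PF x; exists (exist _ I FI).
by have [A hA] := choice annP; exists A.
Qed.

Section Cover.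
Variables (A : P -> filter_ideal).
Hypothesis hA : forall x a, sval (A x) a -> a *: x = 0.

Let prodA : lmodType R := dprod (fun x => cyc (A x)).
Let V : lmodType R := (prodA * P)%type.

(** The element of the direct sum of the modules R/A_x that carries the class of
[i.1] at [i.2]. *)
Definition single (i : R * P) : prodA :=
  fun x => cyc_pi (A x) (if i.2 == x then i.1 else 0).

Definition formal_term (i : R * P) : V := (single i, i.1 *: i.2).

(** The direct sum of the modules R/A_x, encoded as the graph of its evaluation
map sum_x r_x |-> sum_x r_x x inside (prod_x R/A_x) * P.  Finite lists of
coefficients and points are concatenated and scaled without any bookkeeping of
supports, and the evaluation map is a mere projection.  The price is to show
that it is well defined on the coordinates, [cover_eval_eq0]. *)
Definition formal_sums : set V :=
  [set v | exists s : seq (R * P), v = \sum_(i <- s) formal_term i].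

Lemma formal_sums_submodule : is_submodule formal_sums.
Proof.
split; first by exists [::]; rewrite big_nil.
move=> a _ _ [s ->] [s' ->].
exists ([seq (a * i.1, i.2) | i <- s] ++ s'); rewrite big_cat big_map.
congr (_ + _); rewrite scaler_sumr; apply: eq_bigr => -[b x] _ /=.
congr (_, _); last by rewrite /= scalerA.
apply: functional_extensionality_dep => y; rewrite /single /=.
change (a *: cyc_pi (A y) (if x == y then b else 0) =
  cyc_pi (A y) (if x == y then a * b else 0)).
by rewrite scale_cyc_pi; case: ifP => // _; rewrite mulr0.
Qed.

(** Each generator is the coset of 1 at [x] paired with [x], both killed by
[A x]. *)
Lemma formal_sums_torsion : formal_sums `<=` torsion (V := V).
Proof.
have [T0 Tlin] := torsion_submodule V.
move=> _ [s ->]; elim: s => [|[b x] s IHs]; first by rewrite big_nil.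
rewrite big_cons -[formal_term _]scale1r; apply: (Tlin) => //.
have -> : formal_term (b, x) = b *: formal_term (1, x).
  congr (_, _); last by rewrite /= scale1r.
  apply: functional_extensionality_dep => y; rewrite /single /=.
  change (cyc_pi (A y) (if x == y then b else 0) =
    b *: cyc_pi (A y) (if x == y then 1 else 0)).
  by rewrite scale_cyc_pi; case: ifP => // _; rewrite ?mulr1 ?mulr0.
rewrite -[_ *: _]addr0; apply: (Tlin) => //.
exists (sval (A x)); first exact: svalP.
move=> a Aa; congr (_, _); last by rewrite /= scale1r hA.
apply: functional_extensionality_dep => y; rewrite /single /=.
change (a *: cyc_pi (A y) (if x == y then 1 else 0) = 0).
rewrite scale_cyc_pi; apply/cyc_pi_eq0; case: eqP => [<-|_].
  by rewrite mulr1.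
by rewrite mulr0; apply/cyc_pi_eq0; rewrite linear0.
Qed.

Definition cover : lmodType R := submodule formal_sums_submodule.
Definition cover_coord x : {linear cover -> cyc (A x)} :=
  dprod_proj _ x \o (fst : {linear V -> prodA})
    \o sub_incl formal_sums_submodule.
Definition cover_eval : {linear cover -> P} :=
  (snd : {linear V -> P}) \o sub_incl formal_sums_submodule.

Lemma cover_in_gmod : in_gmod F cover.
Proof. exact/torsion_in_gmod/formal_sums_torsion. Qed.

Lemma cover_eval_surj y : exists v, cover_eval v = y.
Proof.
have yD : formal_sums (formal_term (1, y)).
  by exists [:: (1, y)]; rewrite big_seq1.
have [v vE] := sub_incl_onto formal_sums_submodule yD.
by exists v; rewrite -[LHS]/(sub_incl formal_sums_submodule v).2 vE /= scale1r.
Qed.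

(** Collect the terms of a formal sum by their point: if all its coordinates
vanish, the coefficients at [x] add up to an element of [A x], which kills
[x]. *)
Lemma cover_eval_eq0 v : (forall x, cover_coord x v = 0) -> cover_eval v = 0.
Proof.
have [s sE] := sub_incl_in v => v0.
have -> : cover_eval v = \sum_(i <- s) i.1 *: i.2.
  rewrite -[LHS]/(sub_incl formal_sums_submodule v).2 sE.
  rewrite (raddf_sum (snd : {linear V -> P})) /=.
  by apply: eq_bigr.
have c0 x : (\sum_(i <- s | i.2 == x) i.1) *: x = 0.
  apply: hA; apply/cyc_pi_eq0; rewrite linear_sum -[RHS](v0 x).
  rewrite -[RHS]/((sub_incl formal_sums_submodule v).1 x) sE.
  rewrite (raddf_sum (fst : {linear V -> prodA})) /=.
  rewrite -[RHS]/(dprod_proj (fun x => cyc (A x)) x _).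
  rewrite (raddf_sum (dprod_proj (fun x => cyc (A x)) x)) big_mkcond /=.
  by apply: eq_bigr => i _; rewrite /single; case: ifP => // _; rewrite linear0.
(* Each term i occurs for exactly one point x of the list, namely i.2, so the
   sum over i can be exchanged with a sum over the points. *)
rewrite big_seq.
rewrite (eq_bigr (fun i => \sum_(x <- undup (map snd s) | i.2 == x) i.1 *: x)).
  rewrite (exchange_big_dep xpredT) //= big1_seq // => x _.
  rewrite -[RHS](c0 x) scaler_suml [RHS]big_seq_cond.
  by apply: eq_bigl.
move=> i si; rewrite -big_filter (_ : filter _ _ = [:: i.2]) ?big_seq1 //.
rewrite -(filter_pred1_uniq (undup_uniq (map snd s))) ?mem_undup ?map_f //.
by apply: eq_filter => x /=; rewrite eq_sym.
Qed.

End Cover.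

(** A section of the cover has zero coordinates, so its evaluation, which is the
identity of [P], is zero. *)
Lemma projective_eq0 (y : P) : y = 0.
Proof.
have [A hA] := annihilator_choice.
have epi := gmod_epi_of_surj (F := F) (@cover_eval_surj A).
have [g gE] := projP.2 _ _ (cover_eval A) idfun (cover_in_gmod hA) projP.1 epi.
have := gE y => /= <-; apply: (cover_eval_eq0 hA) => x.
exact: (hom_proj_cyc_eq0 (cover_coord A x \o g)).
Qed.

End Projective.

(** * Failure of exactness of products *)

(** The point is uniformity: surjectivity of the product of the maps R/J -> R/K
yields one [I'] for all J, K and r at once. *)
Lemma Ab4star_colon : gmod_Ab4star F -> forall I, exists I' : filter_ideal,
  sval I' `<=` sval I /\
  forall J K r, sval J `<=` sval K -> ideal_colon (sval K) (sval I) r ->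
     ideal_add (ideal_colon (sval J) (sval I')) (sval K) r.
Proof.
move=> ab4 I.
pose T := {t : filter_ideal * filter_ideal * R | sval t.1.1 `<=` sval t.1.2}.
pose num (t : T) := (sval t).1.1; pose den (t : T) := (sval t).1.2.
pose M t := cyc (num t); pose N t := cyc (den t).
pose f t : {linear M t -> N t} := cyc_map (svalP t).
have prodM := gprod_product M; have prodN := gprod_product N.
have [u uE] := (prodN.2 _ (fun t => f t \o gprod_proj M t) prodM.1).1.
have u_epi := ab4 T M N f (fun t => cyc_in_gmod _) (fun t => cyc_in_gmod _)
  (fun t => cyc_map_epi (JK := svalP t)) _ _ _ _ prodM prodN u uE.
have u_surj := gmod_epi_surj prodN.1 u_epi.
(* Entries with r outside (K : I) are set to 0, so that I annihilates y. *)
pose y t : N t :=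
  if `[< ideal_colon (sval (den t)) (sval I) (sval t).2 >]
  then cyc_pi (den t) (sval t).2 else 0.
have [|yN yNE] := gprod_onto (M := N) (x := y) (svalP I).
  move=> t a Ia; rewrite /y; case: asboolP => [Ir|_]; last exact: scaler0.
  by rewrite scale_cyc_pi; apply/cyc_pi_eq0; exact: Ir.
have [x ux] := u_surj yN.
have /in_gmodP/(_ x) [I1 FI1 I1x] := prodM.1.
have [I' [I'I1 I'I]] := filter_ideal_meet (exist _ I1 FI1) I.
exists I'; split=> // J K r JK Kr.
pose t : T := exist _ (J, K, r) JK.
have [s sE] := cyc_pi_surj (gprod_proj M t x).
have sr : cyc_pi K s = cyc_pi K r.
  have yt : gprod_proj N t yN = cyc_pi K r by rewrite yNE /y asboolT.
  by rewrite -yt -ux [RHS](uE t x) -[RHS]/(f t (gprod_proj M t x)) -sE cyc_mapE.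
exists s.
  move=> a I'a; apply/cyc_pi_eq0; rewrite -scale_cyc_pi sE.
  by rewrite -linearZ I1x ?linear0 //; apply: I'I1.
exists (r - s); last by rewrite addrC subrK.
by apply/cyc_pi_eq0; rewrite linearB sr subrr.
Qed.

(** Applied twice, the previous lemma yields I2 inside I1 inside I such that
(I2 : I1) is inside I2 and R = (I : I) is inside (I2 : I1) + I. *)
Lemma Ab4star_trivial : gmod_Ab4star F -> forall I r, sval I r.
Proof.
move=> ab4 I r; case: (hF) => _ Fid _.
case: (Fid _ (svalP I)) => _ ID _ IM.
have [I1 [I1I I1P]] := Ab4star_colon ab4 I.
have [I2 [I2I1 I2P]] := Ab4star_colon ab4 I1.
have [||s sI2 [k Ik <-]] := I1P I2 I r.
- exact: subset_trans I1I.
- by move=> a Ia; apply: IM.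
apply: ID => //; apply/I1I/I2I1/mem_of_colon => L LI2.
exact: I2P.
Qed.

End Filtered.

(* If F = {R}, the category is zero and Ab4* holds trivially, although the
   hypothesis on the ideals is satisfied; (b) excludes this case. *)
Theorem theorem4p2 (R : pzRingType) (F : set (set R))
    (hF : downward_filtered_ideals F)
    (hI : forall I : set R, F I ->
       \bigcap_(J in [set J : set R | F J /\ J `<=` I])
         ideal_add (ideal_colon J I) I = I) :
  (~ exists P : lmodType R, gmod_projective F P /\ exists x : P, x <> 0) /\
  (F <> [set [set: R]] -> ~ gmod_Ab4star F).
Proof.
split.
  by move=> [P [projP [x]]]; apply; exact: (projective_eq0 hF hI projP).
move=> F1 ab4; apply: F1.
have FT I : F I -> I = setT.
  move=> FI; apply/seteqP; split=> // r _.
  exact: (Ab4star_trivial hF hI ab4 (exist _ I FI)).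
apply/seteqP; split; first by move=> I /FT ->.
by move=> _ ->; case: hF => -[I FI] _ _; rewrite -(FT I FI).
Qed.
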